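(* Let $\theta\in[\tfrac12,1]$, $\tau>0$, $\epsilon>0$, $\beta>0$, $S_1,S_2,S_3>0$, and let $(\phi^n)_{n\ge 0}$ (functions on $\Omega$) and $(r^n)_{n\ge0}$ (real numbers) be a solution of the $\mathcal U_W$-method, i.e. for every $n\ge 1$, $$D_\tau^\theta\phi^{n+\theta}=\nabla\cdot\big(M^{*,n+\theta}\nabla\mu^{n+\theta}\big),$$ $$\mu^{n+\theta}=Z^{*,n+\theta}r^{n+\theta}+\frac{S_1}{\epsilon^2}(\phi^{n+1}-2\phi^n+\phi^{n-1})-S_2\Delta(\phi^{n+1}-2\phi^n+\phi^{n-1})+S_3\Delta^2(\phi^{n+1}-2\phi^n+\phi^{n-1}),$$ $$D_\tau^\theta r^{n+\theta}=\frac12\int_\Omega Z^{*,n+\theta}\,D_\tau^\theta\phi^{n+\theta}\,d\Omega .$$ Then the method is unconditionally energy stable (no restriction on $\tau$): for every $n\ge1$, $$\frac1\tau\big(\mathcal E_W^{n+1}-\mathcal E_W^{n}\big)\le-\Big\|\sqrt{M^{*,n+\theta}}\,\nabla\mu^{n+\theta}\Big\|^2\le 0,$$ where $$\mathcal E_W^{n+1}=\left|\begin{bmatrix} r^{n+1}\\ r^n\end{bmatrix}\right|_G^2+\frac{S_1}{\epsilon^2}\frac{\|\phi^{n+1}-\phi^n\|^2}{2}+S_2\frac{\|\nabla\phi^{n+1}-\nabla\phi^n\|^2}{2}+S_3\frac{\|\Delta\phi^{n+1}-\Delta\phi^n\|^2}{2}.$$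
   Context: $\Omega\subset\mathbb R^d$ ($d=2,3$) is a bounded domain; all functions satisfy periodic boundary conditions (so integration by parts produces no boundary terms) and are sufficiently regular that all expressions below are well defined. $\|\cdot\|$ is the $L^2(\Omega)$ norm. Anisotropic quantities: $\mathbf n=\nabla\phi/|\nabla\phi|$, $\gamma(\mathbf n)=1+\alpha\big(4\sum_{i=1}^d n_i^4-3\big)$ with $\alpha\ge0$, $F(\phi)=\frac14(\phi^2-1)^2$, $f(\phi)=F'(\phi)=\phi(\phi^2-1)$, $f'(\phi)=3\phi^2-1$, $$\mathbf m=\gamma(\mathbf n)\nabla\phi+\frac{\mathbb P\nabla_{\mathbf n}\gamma(\mathbf n)}{|\nabla\phi|}\Big(\tfrac12|\nabla\phi|^2+\tfrac1{\epsilon^2}F(\phi)\Big),\qquad \mathbb P=\mathbb I-\mathbf n\mathbf n^T .$$ The mobility $M(\phi)\ge M_0>0$ is a function of $\phi$ or a constant. $$Z(\phi)=\frac{\frac1{\epsilon^2}\gamma(\mathbf n)f(\phi)-\nabla\cdot\mathbf m+\beta\big(\Delta-\frac1{\epsilon^2}f'(\phi)\big)\big(\Delta\phi-\frac1{\epsilon^2}f(\phi)\big)}{\sqrt{\int_\Omega\Big(\gamma(\mathbf n)\big(\frac12|\nabla\phi|^2+\frac1{\epsilon^2}F(\phi)\big)+\frac\beta2\big(\Delta\phi-\frac1{\epsilon^2}f(\phi)\big)^2\Big)d\Omega+C}},$$ where $C>0$ is a constant making the radicand positive. Time discretization with uniform step $\tau$: for any sequence $(u^n)$, $$D_\tau^\theta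 u^{n+\theta}=\frac{(\theta+\frac12)u^{n+1}-2\theta u^n+(\theta-\frac12)u^{n-1}}{\tau},$$ $r^{n+\theta}=\theta r^{n+1}+(1-\theta)r^n$, $\phi^{*,n+\theta}=(1+\theta)\phi^n-\theta\phi^{n-1}$, $Z^{*,n+\theta}=Z(\phi^{*,n+\theta})$, $M^{*,n+\theta}=M(\phi^{*,n+\theta})$; $\mu^{n+\theta}$ is the function defined by the second equation of the scheme. $G$-norm: for real numbers $u,w$, $$\left|\begin{bmatrix}u\\ w\end{bmatrix}\right|_G^2=\frac{\theta(2\theta+3)}2u^2-(\theta+1)(2\theta-1)uw+\frac{\theta(2\theta-1)}2w^2.$$ *)

(* Defs.v *)
From HB Require Import structures.
From mathcomp Require Import all_boot all_order all_algebra.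
From mathcomp Require Import all_classical all_reals all_analysis.
From mathcomp Require Import measurable_realfun.

Set Implicit Arguments.
Unset Strict Implicit.
Unset Printing Implicit Defensive.

Import Order.TTheory GRing.Theory Num.Theory.
Import numFieldNormedType.Exports.

Local Open Scope classical_set_scope.
Local Open Scope ring_scope.

Definition measure_rV_display : measure_display -> measure_display.
Proof. exact. Qed.

(* Row vectors carry the product sigma-algebra; for 'rV[R]_n with R : realType
   this is the Borel sigma-algebra of R^n. *)
Section measurable_rV.
Context {d} {T : sigmaRingType d} (n : nat).

Let coord_rV (i : 'I_n) (v : 'rV[T]_n) : T := v ord0 i.

Let rV_set0 : g_sigma_preimage coord_rV set0.
Proof. exact: sigma_algebra0. Qed.

Let rV_setC A : g_sigma_preimage coord_rV A ->
  g_sigma_preimage coord_rV (~` A).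
Proof. exact: sigma_algebraC. Qed.

Let rV_bigcup (F : _^nat) : (forall i, g_sigma_preimage coord_rV (F i)) ->
  g_sigma_preimage coord_rV (\bigcup_i (F i)).
Proof. exact: sigma_algebra_bigcup. Qed.

HB.instance Definition _ := @isMeasurable.Build (measure_rV_display d)
  'rV[T]_n (g_sigma_preimage coord_rV) rV_set0 rV_setC rV_bigcup.

End measurable_rV.

Lemma measurable_coord_rV d (T : sigmaRingType d) n (i : 'I_n) :
  measurable_fun [set: 'rV[T]_n] (fun v : 'rV[T]_n => v ord0 i).
Proof.
move=> _ Y mY; rewrite setTI; apply: sub_sigma_algebra => /=.
rewrite -bigcup_seq/=; exists i => /=; first by rewrite mem_index_enum.
by exists Y => //; rewrite setTI.
Qed.

Lemma measurable_fun_rVP d1 d2 (T1 : measurableType d1) (T2 : measurableType d2)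
    n (f : T1 -> 'rV[T2]_n) :
  (forall i, measurable_fun [set: T1] (fun x => f x ord0 i)) ->
  measurable_fun [set: T1] f.
Proof.
move=> mf.
suff : g_sigma_preimage (fun i => (fun v : 'rV[T2]_n => v ord0 i) \o f)
    `<=` measurable.
  rewrite g_sigma_preimage_comp => prefS _ A mA.
  by apply: prefS; exists A.
apply: smallest_sub; first exact: sigma_algebra_measurable.
case: n => [|n] in f mf *; first by rewrite big_ord0.
rewrite -bigcup_mkord_ord; apply: bigcup_sub => i Ii.
by move=> A [B mB <-]; exact: mf.
Qed.

Section sigma_finite_measure_of.
Context d (T : measurableType d) (R : realType) (m : {measure set T -> \bar R}).
Hypothesis msf : sigma_finite setT m.

Let copy : set T -> \bar R := m.

HB.instance Definition _ := Measure.on copy.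
HB.instance Definition _ := Measure_isSigmaFinite.Build _ _ _ copy msf.

Lemma sigma_finite_measure_of :
  {m' : {sigma_finite_measure set T -> \bar R} | m' = m :> (set T -> \bar R)}.
Proof. by exists copy. Qed.

End sigma_finite_measure_of.

Section lebesgue_rV.
Context (R : realType).

(* n-dimensional Lebesgue measure, obtained by slicing along the first
   coordinate; see lebesgue_rV_openbox for its value on boxes. *)
Fixpoint lebesgue_rV (n : nat) : set 'rV[R]_n -> \bar R :=
  match n with
  | 0 => fun A => \d_(0 : 'rV[R]_0) A
  | m.+1 => fun A =>
      (\int[@lebesgue_measure R]_x
         lebesgue_rV [set t : 'rV[R]_m | A (row_mx x%:M t : 'rV[R]_m.+1)])%E
  end.

Let cons_rV n (p : R * 'rV[R]_n) : 'rV[R]_n.+1 := row_mx p.1%:M p.2.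
Let uncons_rV n (v : 'rV[R]_n.+1) : R * 'rV[R]_n :=
  (v ord0 ord0, \row_i v ord0 (lift ord0 i)).

Let cons_rV0 n p : @cons_rV n p ord0 ord0 = p.1.
Proof.
rewrite /cons_rV mxE; case: splitP => [j _|k] //.
by rewrite (ord1 j) mxE.
Qed.

Let cons_rVS n p i : @cons_rV n p ord0 (lift ord0 i) = p.2 ord0 i.
Proof.
rewrite /cons_rV mxE; case: splitP => [j /= /eqP|k /= /eqP].
  by rewrite ord1.
by rewrite /bump /= eqSS => /eqP /val_inj ->.
Qed.

Let cons_rVK n : cancel (@cons_rV n) (@uncons_rV n).
Proof.
move=> [x t]; rewrite /uncons_rV cons_rV0; congr pair.
by apply/rowP => i; rewrite mxE cons_rVS.
Qed.

Let uncons_rVK n : cancel (@uncons_rV n) (@cons_rV n).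
Proof.
move=> v; apply/rowP => i; case: (unliftP ord0 i) => [j ->|->].
  by rewrite cons_rVS mxE.
by rewrite cons_rV0.
Qed.

Let measurable_cons_rV n : measurable_fun setT (@cons_rV n).
Proof.
apply: measurable_fun_rVP => i; case: (unliftP ord0 i) => [j ->|->].
  under eq_fun do rewrite cons_rVS.
  exact: (measurableT_comp (measurable_coord_rV j) measurable_snd).
under eq_fun do rewrite cons_rV0.
exact: measurable_fst.
Qed.

Let measurable_uncons_rV n : measurable_fun setT (@uncons_rV n).
Proof.
apply: measurable_fun_pair; first exact: measurable_coord_rV.
apply: measurable_fun_rVP => i; under eq_fun do rewrite mxE.
exact: measurable_coord_rV.
Qed.

Let lebesgue_rV_measure n :
  {m : {sigma_finite_measure set 'rV[R]_n -> \bar R} |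
    lebesgue_rV (n := n) = m}.
Proof.
suff [m lebE msf] : {m : {measure set 'rV[R]_n -> \bar R} |
    lebesgue_rV (n := n) = m & sigma_finite setT m}.
  by have [m' m'E] := sigma_finite_measure_of msf; exists m'; rewrite m'E.
elim: n => [|n [m0 lebE /sigma_finite_measure_of[m2 m2E]]].
  exists (@dirac _ 'rV[R]_0 0 R) => //.
  apply: fin_num_fun_sigma_finite; first by rewrite measure0.
  by move=> A _; rewrite /= diracE.
exists (measure_function_pushforward__canonical__measure_function_Measure
  (@lebesgue_measure R \x m2)%E (@measurable_cons_rV n)).
  apply/funext => A; rewrite /= lebE; apply: eq_integral => x _ /=.
  rewrite -m2E; congr (m2 _); apply/seteqP; split => t /=.
    by move=> At; rewrite /xsection/= inE.
  by rewrite /xsection/= inE.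
have /sigma_finiteP[F [TF ndF Foo]] := sigma_finiteT (@lebesgue_measure R).
have /sigma_finiteP[G [TG ndG Goo]] := sigma_finiteT m2.
exists (fun i => @uncons_rV n @^-1` (F i `*` G i)).
  rewrite -preimage_bigcup; apply/esym/seteqP; split => // v _.
  have : [set: R] (uncons_rV v).1 by [].
  have : [set: 'rV[R]_n] (uncons_rV v).2 by [].
  rewrite TF TG => -[k _ Gk] [m _ Fm]; exists (maxn m k) => //; split.
    by move: Fm; exact/subsetPset/ndF/leq_maxl.
  by move: Gk; exact/subsetPset/ndG/leq_maxr.
move=> i; have [mFi Fioo] := Foo i; have [mGi Gioo] := Goo i; split.
  rewrite -[X in measurable X]setTI; apply: measurable_uncons_rV => //.
  exact: measurableX.
rewrite /= /pushforward -comp_preimage.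
rewrite (_ : uncons_rV (n := n) \o cons_rV (n := n) = id); last first.
  exact/funext/cons_rVK.
by rewrite preimage_id product_measure1E// lte_mul_pinfty// ge0_fin_numE.
Qed.

Let lebesgue_rV0 n : lebesgue_rV (set0 : set 'rV[R]_n) = 0%E.
Proof. by case: (lebesgue_rV_measure n) => m ->; exact: measure0. Qed.

Let lebesgue_rV_ge0 n (A : set 'rV[R]_n) : (0 <= lebesgue_rV A)%E.
Proof. by case: (lebesgue_rV_measure n) => m ->; exact: measure_ge0. Qed.

Let lebesgue_rV_sigma_additive n :
  semi_sigma_additive (lebesgue_rV (n := n)).
Proof.
case: (lebesgue_rV_measure n) => m ->.
exact: measure_semi_sigma_additive.
Qed.

HB.instance Definition _ n := isMeasure.Build _ _ _ (lebesgue_rV (n := n))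
  (@lebesgue_rV0 n) (@lebesgue_rV_ge0 n) (@lebesgue_rV_sigma_additive n).

Let lebesgue_rV_sigma_finite n : sigma_finite setT (lebesgue_rV (n := n)).
Proof. by case: (lebesgue_rV_measure n) => m ->; exact: sigma_finiteT. Qed.

HB.instance Definition _ n := Measure_isSigmaFinite.Build _ _ _
  (lebesgue_rV (n := n)) (@lebesgue_rV_sigma_finite n).

End lebesgue_rV.

Definition openbox (R : realType) (d : nat) (a b : 'rV[R]_d) : set 'rV[R]_d :=
  [set x | forall i, a ord0 i < x ord0 i < b ord0 i].

Lemma lebesgue_rV_openbox (R : realType) d (a b : 'rV[R]_d) :
  (forall i, a ord0 i < b ord0 i) ->
  lebesgue_rV (openbox a b) = (\prod_(i < d) (b ord0 i - a ord0 i))%:E.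
Proof.
elim: d a b => [|d IHd] a b ab.
  rewrite big_ord0 /= diracE mem_set// => i; by case: i.
rewrite big_ord_recl /=.
pose a' := \row_i a ord0 (lift ord0 i); pose b' := \row_i b ord0 (lift ord0 i).
have IH : lebesgue_rV (openbox a' b') =
    (\prod_(i < d) (b ord0 (lift ord0 i) - a ord0 (lift ord0 i)))%:E.
  rewrite IHd; last by move=> i; rewrite !mxE.
  by congr (_%:E); apply: eq_bigr => i _; rewrite !mxE.
set c := (X in (_ * X)%:E).
have c0 : 0 <= c by apply: prodr_ge0 => i _; rewrite subr_ge0 ltW.
have measI : measurable (`]a ord0 ord0, b ord0 ord0[ : set (measurableTypeR R)).
  exact: measurable_itv.
transitivity (\int[@lebesgue_measure R]_x
    (c%:E * (\1_(`]a ord0 ord0, b ord0 ord0[%classic) x)%:E))%E.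
  apply: eq_integral => x _.
  have rowS t i : (row_mx x%:M t : 'rV[R]_d.+1) ord0 (lift ord0 i) = t ord0 i.
    by rewrite mxE; case: splitP => [j /= /eqP|k /= [] /val_inj ->] //; rewrite ord1.
  have row0 (t : 'rV[R]_d) : (row_mx x%:M t : 'rV[R]_d.+1) ord0 ord0 = x.
    by rewrite mxE; case: splitP => [j _|k] //; rewrite (ord1 j) mxE.
  have [xab|xab] := boolP (x \in `]a ord0 ord0, b ord0 ord0[).
    rewrite indicE mem_set// mule1 -IH; congr (lebesgue_rV _).
    apply/seteqP; split => t /= tab i.
      by have := tab (lift ord0 i); rewrite rowS !mxE.
    case: (unliftP ord0 i) => [j ->|->].
      by have := tab j; rewrite rowS !mxE.
    by rewrite row0; move: xab; rewrite in_itv.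
  rewrite indicE memNset; last by apply/negP.
  rewrite mule0 -[RHS](measure0 (@lebesgue_rV R d)); congr (lebesgue_rV _).
  apply/seteqP; split => // t /= /(_ ord0); rewrite row0 => xab'.
  by move/negP: xab; apply; rewrite in_itv.
have muI : lebesgue_measure (`]a ord0 ord0, b ord0 ord0[ : set R) =
    (b ord0 ord0 - a ord0 ord0)%:E.
  by rewrite lebesgue_measure_itv/= lte_fin ab.
rewrite ge0_integralZl//.
- rewrite integral_indic//.
  by rewrite setIT [X in (_ * X)%E]muI -EFinM mulrC.
- exact/measurable_EFinP/measurable_indic.
Qed.

Section calculus.
Context (R : realType) (d : nat).
Implicit Types (g : 'rV[R]_d -> R) (V : 'rV[R]_d -> 'rV[R]_d).

Definition partial (i : 'I_d) g : 'rV[R]_d -> R :=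
  fun x => 'D_(delta_mx ord0 i) g x.

Definition grad g : 'rV[R]_d -> 'rV[R]_d := fun x => \row_i partial i g x.

Definition divergence V : 'rV[R]_d -> R :=
  fun x => \sum_(i < d) partial i (fun y => V y ord0 i) x.

Definition laplacian g : 'rV[R]_d -> R :=
  fun x => \sum_(i < d) partial i (partial i g) x.

Fixpoint Ck (k : nat) g : Prop :=
  match k with
  | 0 => continuous g
  | m.+1 => continuous g /\
      forall i, (forall x, derivable g x (delta_mx ord0 i)) /\ Ck m (partial i g)
  end.

(* The library's norm `|v| on 'rV is the sup norm. *)
Definition enorm (v : 'rV[R]_d) : R := Num.sqrt (\sum_(i < d) v ord0 i ^+ 2).

(* Periodic boundary conditions on openbox a b: the function is the restriction
   of a function on R^d with period b_i - a_i in the i-th direction. *)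
Definition periodic_box (a b : 'rV[R]_d) g : Prop :=
  forall i, periodic g ((b ord0 i - a ord0 i) *: delta_mx ord0 i).

Definition integral_box (a b : 'rV[R]_d) g : R :=
  \int[lebesgue_rV (n := d)]_(x in openbox a b) g x.

Definition L2norm (a b : 'rV[R]_d) g : R :=
  Num.sqrt (integral_box a b (fun x => g x ^+ 2)).

End calculus.

Section anisotropic.
Context (R : realType) (d : nat).
Variables (a b : 'rV[R]_d) (alpha beta eps C : R).
Implicit Types phi : 'rV[R]_d -> R.

Definition gamma (n : 'rV[R]_d) : R :=
  1 + alpha * (4 * (\sum_(i < d) n ord0 i ^+ 4) - 3).

Definition potF (u : R) : R := (u ^+ 2 - 1) ^+ 2 / 4.
Definition potf (u : R) : R := u * (u ^+ 2 - 1).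
Definition potf' (u : R) : R := 3 * u ^+ 2 - 1.

(* Since 0^-1 = 0, both unit_normal phi x and mvec phi x vanish where
   grad phi x = 0. *)
Definition unit_normal phi (x : 'rV[R]_d) : 'rV[R]_d :=
  (enorm (grad phi x))^-1 *: grad phi x.

Definition tangent_proj (n : 'rV[R]_d) : 'M[R]_d := 1%:M - n^T *m n.

Definition local_energy phi (x : 'rV[R]_d) : R :=
  enorm (grad phi x) ^+ 2 / 2 + potF (phi x) / eps ^+ 2.

(* Vectors are rows and tangent_proj n is symmetric, so v *m tangent_proj n
   is P v. *)
Definition mvec phi (x : 'rV[R]_d) : 'rV[R]_d :=
  let n := unit_normal phi x in
  gamma n *: grad phi x +
  (local_energy phi x / enorm (grad phi x)) *: (grad gamma n *m tangent_proj n).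

Definition willmore phi (x : 'rV[R]_d) : R :=
  laplacian phi x - potf (phi x) / eps ^+ 2.

Definition radicand phi : R :=
  integral_box a b (fun x =>
    gamma (unit_normal phi x) * local_energy phi x + beta / 2 * willmore phi x ^+ 2)
  + C.

Definition Zfun phi (x : 'rV[R]_d) : R :=
  (gamma (unit_normal phi x) * potf (phi x) / eps ^+ 2 - divergence (mvec phi) x
   + beta * (laplacian (willmore phi) x
             - potf' (phi x) / eps ^+ 2 * willmore phi x))
  / Num.sqrt (radicand phi).

End anisotropic.

Section scheme.
Context (R : realType) (d : nat).
Variables (a b : 'rV[R]_d) (alpha beta eps C : R) (M : R -> R).
Variables (theta tau S1 S2 S3 : R).
Variables (phi : nat -> 'rV[R]_d -> R) (r : nat -> R).

(* Time levels n + theta are indexed by n, for n >= 1, so that n.-1 is the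
   previous level: Dtau u n is D_tau^theta u^(n+theta), and so on. *)
Definition Dtau (u : nat -> R) (n : nat) : R :=
  ((theta + 1 / 2) * u n.+1 - 2 * theta * u n + (theta - 1 / 2) * u n.-1) / tau.

Definition Dtau_phi (n : nat) (x : 'rV[R]_d) : R := Dtau (fun k => phi k x) n.

Definition r_theta (n : nat) : R := theta * r n.+1 + (1 - theta) * r n.

Definition phi_star (n : nat) (x : 'rV[R]_d) : R :=
  (1 + theta) * phi n x - theta * phi n.-1 x.

Definition Z_star (n : nat) : 'rV[R]_d -> R :=
  Zfun a b alpha beta eps C (phi_star n).

Definition M_star (n : nat) (x : 'rV[R]_d) : R := M (phi_star n x).

Definition delta2_phi (n : nat) (x : 'rV[R]_d) : R :=
  phi n.+1 x - 2 * phi n x + phi n.-1 x.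

(* mu stands for mu^(n+theta). Its defining equation is required almost
   everywhere, as Z_star is singular at critical points of phi_star. *)
Record UW_step (n : nat) (mu : 'rV[R]_d -> R) : Prop := {
  UW_phi : forall x, openbox a b x ->
    Dtau_phi n x = divergence (fun y => M_star n y *: grad mu y) x;
  UW_mu : {ae lebesgue_rV (n := d), forall x, openbox a b x ->
    mu x = Z_star n x * r_theta n
           + S1 / eps ^+ 2 * delta2_phi n x
           - S2 * laplacian (delta2_phi n) x
           + S3 * laplacian (laplacian (delta2_phi n)) x};
  UW_r : Dtau r n = integral_box a b (fun x => Z_star n x * Dtau_phi n x) / 2
}.

(* Classical regularity making every expression in UW_step n mu well defined. *)
Record UW_regular (n : nat) (mu : 'rV[R]_d -> R) : Prop := {
  UW_integrable : (lebesgue_rV (n := d)).-integrable (openbox a b)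
    (fun x => (Z_star n x * Dtau_phi n x)%:E);
  UW_mu_periodic : periodic_box a b mu;
  UW_mu_C1 : Ck 1 mu;
  UW_flux_C1 : forall i, Ck 1 (fun x => M_star n x * partial i mu x)
}.

Definition Gnorm2 (u w : R) : R :=
  theta * (2 * theta + 3) / 2 * u ^+ 2
  - (theta + 1) * (2 * theta - 1) * u * w
  + theta * (2 * theta - 1) / 2 * w ^+ 2.

(* The energy at level n >= 1. *)
Definition E_W (n : nat) : R :=
  Gnorm2 (r n) (r n.-1)
  + S1 / eps ^+ 2 * (L2norm a b (fun x => phi n x - phi n.-1 x) ^+ 2 / 2)
  + S2 * (L2norm a b
            (fun x => enorm (grad (phi n) x - grad (phi n.-1) x)) ^+ 2 / 2)
  + S3 * (L2norm a b
            (fun x => laplacian (phi n) x - laplacian (phi n.-1) x) ^+ 2 / 2).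

Definition dissipation (n : nat) (mu : 'rV[R]_d -> R) : R :=
  L2norm a b (fun x => enorm (Num.sqrt (M_star n x) *: grad mu x)) ^+ 2.

End scheme.

(* Main.v *)
(** Write [p = phi^(n+1) - phi^n], [q = phi^n - phi^(n-1)] and
[w = D_tau^theta phi^(n+theta)], so that [tau w = (theta + 1/2) p - (theta - 1/2) q].
Testing the first equation of the scheme with [mu], the second with [w] and
multiplying the third by [2 r^(n+theta)] gives
[- |sqrt M grad mu|^2 = 2 r^(n+theta) D_tau r + S1/eps^2 (p - q, w)
+ S2 (grad (p - q), grad w) + S3 (laplacian (p - q), laplacian w)].
The two quadratic identities
[(p - q) tau w = (p^2 - q^2)/2 + theta (p - q)^2] and
[2 tau r^(n+theta) D_tau r = |(r^(n+1), r^n)|_G^2 - |(r^n, r^(n-1))|_G^2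
+ theta (2 theta - 1)/2 (r^(n+1) - 2 r^n + r^(n-1))^2]
then bound the right-hand side from below by the energy increment over [tau].
The integrations by parts reduce to: the integral over a period box of a partial
derivative of a periodic function vanishes, by Fubini and the fundamental theorem
of calculus in one coordinate. *)
Require Import Defs.
From mathcomp Require Import all_boot all_order all_algebra.
From mathcomp Require Import all_classical all_reals all_analysis.
From mathcomp Require Import measurable_realfun lra ring.

Set Implicit Arguments.
Unset Strict Implicit.
Unset Printing Implicit Defensive.

Import Order.TTheory GRing.Theory Num.Theory.
Import numFieldNormedType.Exports.
Local Open Scope classical_set_scope.
Local Open Scope ring_scope.

(** * Lebesgue integral on boxes *)

Lemma measurable_openbox (R : realType) (d : nat) (a b : 'rV[R]_d) :
  measurable (openbox a b).
Proof.
have -> : openbox a b = \bigcap_(i in [set: 'I_d])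
    ((fun x : 'rV[R]_d => x ord0 i) @^-1` `]a ord0 i, b ord0 i[%classic).
  by apply/seteqP; split => [x abx i _|x abx i];
    have := abx i; rewrite /= in_itv //; exact.
apply: fin_bigcap_measurable => [|i _]; first exact: finite_finset.
rewrite -[X in measurable X]setTI.
by apply: (measurable_coord_rV i) => //; exact: measurable_itv.
Qed.

(** An open set is a countable union of boxes with rational corners. This links the sup-norm
    topology to the sigma-algebra generated by the coordinates. *)
Lemma open_measurable_rV (R : realType) (d : nat) (U : set 'rV[R]_d) :
  open U -> measurable U.
Proof.
move=> Uo; pose box (pq : 'rV[rat]_d * 'rV[rat]_d) : set 'rV[R]_d :=
  openbox (map_mx ratr pq.1) (map_mx ratr pq.2).
(* Enumerates the pairs of rational corners; an index that codes no box inside [U] contributes the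
   empty set. *)
pose F (k : nat) : set 'rV[R]_d :=
  if unpickle k is Some pq then
    if `[< box pq `<=` U >] then box pq else set0 else set0.
have -> : U = \bigcup_k F k.
  apply/seteqP; split => [x Ux|x [k _]]; last first.
    rewrite /F; case: (unpickle k) => // pq.
    by case: ifPn => [/asboolP + bx|//]; exact.
  have /nbhs_ballP[e /= e0 xeU] := open_nbhs_nbhs (conj Uo Ux).
  have lo i : {q : rat | ratr q \in `]x ord0 i - e, x ord0 i[}.
    by apply/cid/rat_in_itvoo; rewrite ltrBlDr ltrDl.
  have hi i : {q : rat | ratr q \in `]x ord0 i, x ord0 i + e[}.
    by apply/cid/rat_in_itvoo; rewrite ltrDl.
  pose p : 'rV[rat]_d := \row_i sval (lo i).
  pose q : 'rV[rat]_d := \row_i sval (hi i).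
  have pqU : box (p, q) `<=` U.
    move=> y pqy; apply: xeU; split => // i j; rewrite (ord1 i).
    have := pqy j; rewrite !mxE.
    have := svalP (lo j); have := svalP (hi j); rewrite !in_itv/=.
    move=> /andP[_ qx] /andP[px _] /andP[py yq].
    by rewrite /ball/= ltr_distlC (lt_trans px py) (lt_trans yq qx).
  exists (pickle (p, q)) => //; rewrite /F pickleK; case: asboolP => // _ i.
  rewrite !mxE; have := svalP (lo i); have := svalP (hi i); rewrite !in_itv/=.
  by move=> /andP[-> _] /andP[_ ->].
apply: bigcupT_measurable => k; rewrite /F; case: (unpickle k) => // pq.
by case: ifPn => // _; exact: measurable_openbox.
Qed.

Lemma continuous_measurable_rV (R : realType) (d : nat) (g : 'rV[R]_d -> R) :
  continuous g -> measurable_fun setT g.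
Proof.
move=> /continuousP cg; apply: (measurability _ (RGenOpens.measurableE R)).
move=> _ [_ [a [b ->] <-]]; rewrite setTI; apply: open_measurable_rV.
exact/cg/interval_open.
Qed.

(** The open box has finite measure, and [g] is bounded on it because it is continuous on the
    compact closed box. *)
Lemma continuous_box_integrable (R : realType) (d : nat) (a b : 'rV[R]_d)
    (g : 'rV[R]_d -> R) : (forall i, a ord0 i < b ord0 i) -> continuous g ->
  (lebesgue_rV (n := d)).-integrable (openbox a b) (EFin \o g).
Proof.
move=> ab cg; apply: measurable_bounded_integrable.
- exact: measurable_openbox.
- by rewrite [ltLHS](lebesgue_rV_openbox ab) ltry.
- by apply: measurable_funTS; exact: continuous_measurable_rV.
- have cB : compact [set v : 'rV[R]_d |
      forall i, `[a ord0 i, b ord0 i]%classic (v ord0 i)].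
    apply: (@rV_compact R d (fun i => `[a ord0 i, b ord0 i]%classic)) => i.
    exact: segment_compact.
  have /compact_bounded[M [Mr HM]] : compact (g @` [set v : 'rV[R]_d |
      forall i, `[a ord0 i, b ord0 i]%classic (v ord0 i)]).
    by apply: continuous_compact => //; exact: continuous_subspaceT.
  exists M; split => // N MN x abx; apply: HM => //; exists x => // i /=.
  by rewrite in_itv/= !ltW//; case/andP: (abx i).
Qed.

(** * Splitting off the first coordinate and Fubini's theorem on boxes *)

Definition cons_rV (T : pzSemiRingType) (n : nat) (x : T) (t : 'rV[T]_n) :
  'rV[T]_n.+1 := row_mx x%:M t.

Definition behead_rV (T : Type) (n : nat) (v : 'rV[T]_n.+1) : 'rV[T]_n :=
  \row_i v ord0 (lift ord0 i).

Lemma cons_rV0 (T : pzSemiRingType) (n : nat) (x : T) (t : 'rV[T]_n) :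
  cons_rV x t ord0 ord0 = x.
Proof.
rewrite /cons_rV mxE; case: splitP => [j _|k] //.
by rewrite (ord1 j) mxE.
Qed.

Lemma cons_rVS (T : pzSemiRingType) (n : nat) (x : T) (t : 'rV[T]_n) i :
  cons_rV x t ord0 (lift ord0 i) = t ord0 i.
Proof.
rewrite /cons_rV mxE; case: splitP => [j /= /eqP|k /= /eqP].
  by rewrite ord1.
by rewrite /bump /= eqSS => /eqP /val_inj ->.
Qed.

Lemma rV_consP (T : pzSemiRingType) (n : nat) (u v : 'rV[T]_n.+1) :
  u ord0 ord0 = v ord0 ord0 ->
  (forall i, u ord0 (lift ord0 i) = v ord0 (lift ord0 i)) -> u = v.
Proof.
by move=> uv0 uvS; apply/rowP => i; case: (unliftP ord0 i) => [j ->|->].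
Qed.

Lemma openbox_cons (R : realType) (n : nat) (a b : 'rV[R]_n.+1) x t :
  openbox a b (cons_rV x t) <->
  `]a ord0 ord0, b ord0 ord0[%classic x /\
    openbox (behead_rV a) (behead_rV b) t.
Proof.
split=> [abxt|[abx abt] i].
  split=> [|i]; first by have := abxt ord0; rewrite cons_rV0 /= in_itv.
  by have := abxt (lift ord0 i); rewrite cons_rVS !mxE.
case: (unliftP ord0 i) => [j ->|->].
  by have := abt j; rewrite cons_rVS !mxE.
by rewrite cons_rV0; move: abx; rewrite /= in_itv.
Qed.

Lemma measurable_cons_rV (R : realType) (n : nat) :
  measurable_fun [set: measurableTypeR R * 'rV[R]_n] (fun p => cons_rV p.1 p.2).
Proof.
apply: measurable_fun_rVP => i; case: (unliftP ord0 i) => [j ->|->].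
  under eq_fun do rewrite cons_rVS.
  exact: (measurableT_comp (measurable_coord_rV j) measurable_snd).
under eq_fun do rewrite cons_rV0.
exact: measurable_fst.
Qed.

Section slicing.
Local Open Scope ereal_scope.
Context (R : realType) (n : nat).

Let prod_leb : {measure set (measurableTypeR R * 'rV[R]_n) -> \bar R} :=
  (@lebesgue_measure R \x lebesgue_rV (n := n)).

Let leb_push :=
  measure_function_pushforward__canonical__measure_function_Measure
    prod_leb (@measurable_cons_rV R n).

(** The recursion defining [lebesgue_rV] integrates the measures of slices, which is how the product
    measure is computed. Fubini's theorem becomes available through this identification. *)
Let leb_pushE (A : set 'rV[R]_n.+1) : lebesgue_rV A = leb_push A.
Proof.
apply: eq_integral => x _ /=; congr lebesgue_rV.
by apply/seteqP; split => t /=; rewrite /xsection/= inE.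
Qed.

Context (a b : 'rV[R]_n.+1) (f : 'rV[R]_n.+1 -> R).
Hypothesis mf : measurable_fun setT f.
Hypothesis intf :
  (lebesgue_rV (n := n.+1)).-integrable (openbox a b) (EFin \o f).

Let I : set (measurableTypeR R) := `]a ord0 ord0, b ord0 ord0[%classic.
Let B : set 'rV[R]_n := openbox (behead_rV a) (behead_rV b).
Let F (p : measurableTypeR R * 'rV[R]_n) : \bar R := (f (cons_rV p.1 p.2))%:E.

Let preimageB : (fun p => cons_rV p.1 p.2) @^-1` openbox a b = I `*` B.
Proof. by apply/seteqP; split => -[x t] /openbox_cons. Qed.

Let integrable_prod : prod_leb.-integrable (I `*` B) F.
Proof.
rewrite -preimageB; apply/integrableP; split.
  apply: measurable_funTS; apply/measurable_EFinP.
  exact: (measurableT_comp mf (@measurable_cons_rV R n)).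
(* Change of variables for the absolute value brings the bound back to [intf]. *)
rewrite -(@ge0_integral_pushforward _ _ _ _ _ _ (@measurable_cons_rV R n)
  prod_leb _ (fun v => `|(f v)%:E|))//.
- rewrite (eq_measure_integral (lebesgue_rV (n := n.+1))).
  - by case/integrableP : intf.
  - exact: measurable_cons_rV.
  - by move=> ? A _ _; exact/esym/leb_pushE.
- exact: measurable_openbox.
- apply: measurable_funTS; apply: measurableT_comp => //.
  exact/measurable_EFinP.
Qed.

(** The integrand is extended by zero outside the box, so that Fubini's theorem can be applied on
    the whole product space. *)
Let integral_prod :
  \int[lebesgue_rV (n := n.+1)]_(v in openbox a b) (f v)%:E =
  \int[prod_leb]_p (F \_ (I `*` B)) p.
Proof.
rewrite -integral_mkcond -preimageB.
rewrite -(@integral_pushforward _ _ _ _ _ _ (@measurable_cons_rV R n)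
  prod_leb (openbox a b) (EFin \o f)).
- by apply: (eq_measure_integral leb_push) => A _ _; exact: leb_pushE.
- exact/measurable_EFinP.
- by rewrite preimageB; exact: integrable_prod.
- exact: measurable_openbox.
Qed.

Let integrable_patch : prod_leb.-integrable setT (F \_ (I `*` B)).
Proof.
apply/integrable_restrict => //; last by rewrite setTI.
by apply: measurableX; [exact: measurable_itv|exact: measurable_openbox].
Qed.

Lemma integral_openbox_cons :
  \int[lebesgue_rV (n := n.+1)]_(v in openbox a b) (f v)%:E =
  \int[@lebesgue_measure R]_(x in `]a ord0 ord0, b ord0 ord0[)
    \int[lebesgue_rV (n := n)]_(t in openbox (behead_rV a) (behead_rV b))
      (f (cons_rV x t))%:E.
Proof.
rewrite integral_prod; apply: etrans.
  exact: (esym (@integral12_prod_meas1 _ _ _ _ R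
    (@lebesgue_measure R) (lebesgue_rV (n := n)) _ integrable_patch)).
rewrite [RHS]integral_mkcond; apply: eq_integral => x _.
rewrite /= /fubini_F patchE; case: ifPn => xI.
  rewrite [RHS]integral_mkcond; apply: eq_integral => t _.
  by rewrite !patchE in_setX /= xI.
by apply: integral0_eq => t _; rewrite patchE in_setX /= (negbTE xI).
Qed.

(** Both orders of integration serve later: the variable of differentiation has to be the inner
    one. *)
Lemma integral_openbox_cons_swap :
  \int[lebesgue_rV (n := n.+1)]_(v in openbox a b) (f v)%:E =
  \int[lebesgue_rV (n := n)]_(t in openbox (behead_rV a) (behead_rV b))
    \int[@lebesgue_measure R]_(x in `]a ord0 ord0, b ord0 ord0[)
      (f (cons_rV x t))%:E.
Proof.
rewrite integral_prod; apply: etrans.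
  exact: (esym (@integral21_prod_meas1 _ _ _ _ R
    (@lebesgue_measure R) (lebesgue_rV (n := n)) _ integrable_patch)).
rewrite [RHS]integral_mkcond; apply: eq_integral => t _.
rewrite /= /fubini_G patchE; case: ifPn => tB.
  rewrite [RHS]integral_mkcond; apply: eq_integral => x _.
  by rewrite !patchE in_setX /= tB andbT.
by apply: integral0_eq => x _; rewrite patchE in_setX /= (negbTE tB) andbF.
Qed.

End slicing.

(** * Differentiability classes and integration by parts *)

Section differentiability_class.
Context (R : realType) (d : nat).
Implicit Types (f g : 'rV[R]_d -> R).

Lemma Ck_continuous k g : Ck k g -> continuous g.
Proof. by case: k => [|k] //= []. Qed.

Lemma CkW k g : Ck k.+1 g -> Ck k g.
Proof.
elim: k g => [|k IHk] g [cg dg] //; split=> // i.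
by have [dgi Cgi] := dg i; split=> //; exact: IHk.
Qed.

Lemma Ck_leq m k g : (m <= k)%N -> Ck k g -> Ck m g.
Proof.
move/subnK <-; elim: (k - m)%N => [|j IHj] //.
by rewrite addSn => /CkW; exact: IHj.
Qed.

Lemma Ck_partial k i g : Ck k.+1 g -> Ck k (partial i g).
Proof. by move=> [_ /(_ i)[]]. Qed.

Lemma Ck_derivable k g : Ck k.+1 g ->
  forall i x, derivable g x (delta_mx ord0 i).
Proof. by move=> [_ dg] i; have [] := dg i. Qed.

Lemma partialD i f g : Ck 1 f -> Ck 1 g ->
  partial i (fun x => f x + g x) = fun x => partial i f x + partial i g x.
Proof.
move=> Cf Cg; apply/funext => x; rewrite /partial.
by rewrite -deriveD //; [exact: (Ck_derivable Cf)|exact: (Ck_derivable Cg)].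
Qed.

Lemma partialZ i c f : Ck 1 f ->
  partial i (fun x => c * f x) = fun x => c * partial i f x.
Proof.
move=> Cf; apply/funext => x; rewrite /partial.
by rewrite -[RHS](deriveZ c) //; exact: (Ck_derivable Cf).
Qed.

Lemma partialM i f g : Ck 1 f -> Ck 1 g ->
  partial i (fun x => f x * g x) =
  fun x => partial i f x * g x + f x * partial i g x.
Proof.
move=> Cf Cg; apply/funext => x; rewrite /partial.
rewrite [LHS](@deriveM _ _ f g); [|exact: (Ck_derivable Cf)|exact: (Ck_derivable Cg)].
by rewrite addrC; congr (_ + _); rewrite mulrC.
Qed.

Lemma partial_cst i (c : R) : partial i (cst c : 'rV[R]_d -> R) = cst 0.
Proof. by apply/funext => x; exact: derive_cst. Qed.

Lemma Ck_cst k (c : R) : Ck k (cst c : 'rV[R]_d -> R).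
Proof.
elim: k c => [|k IHk] c; first exact: cst_continuous.
split=> [|i]; first exact: cst_continuous.
by split=> [x|]; [exact: derivable_cst|rewrite partial_cst; exact: IHk].
Qed.

Lemma CkD k f g : Ck k f -> Ck k g -> Ck k (fun x => f x + g x).
Proof.
elim: k f g => [|k IHk] f g Cf Cg.
  by move=> x; apply: continuousD; [exact: Cf|exact: Cg].
split=> [x|i].
  by apply: continuousD; [exact: (Ck_continuous Cf)|exact: (Ck_continuous Cg)].
split=> [x|].
  by apply: derivableD; [exact: (Ck_derivable Cf)|exact: (Ck_derivable Cg)].
rewrite partialD; [|exact: Ck_leq Cf|exact: Ck_leq Cg].
by apply: IHk; exact: Ck_partial.
Qed.

Lemma CkM k f g : Ck k f -> Ck k g -> Ck k (fun x => f x * g x).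
Proof.
elim: k f g => [|k IHk] f g Cf Cg.
  by move=> x; apply: continuousM; [exact: Cf|exact: Cg].
split=> [x|i].
  by apply: continuousM; [exact: (Ck_continuous Cf)|exact: (Ck_continuous Cg)].
split=> [x|].
  by apply: derivableM; [exact: (Ck_derivable Cf)|exact: (Ck_derivable Cg)].
rewrite partialM; [|exact: Ck_leq Cf|exact: Ck_leq Cg].
by apply: CkD; apply: IHk; (exact: Ck_partial || exact: CkW).
Qed.

Lemma CkZ k c f : Ck k f -> Ck k (fun x => c * f x).
Proof. by move=> Cf; apply: CkM => //; exact: (Ck_cst k c). Qed.

Lemma Ck_sum k n (F : 'I_n -> 'rV[R]_d -> R) :
  (forall i, Ck k (F i)) -> Ck k (fun x => \sum_(i < n) F i x).
Proof.
elim: n F => [|n IHn] F CF.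
  by under eq_fun do rewrite big_ord0; exact: Ck_cst.
under eq_fun do rewrite big_ord_recr.
by apply: CkD => //; exact: IHn.
Qed.

Lemma Ck_laplacian k g : Ck k.+2 g -> Ck k (laplacian g).
Proof. by move=> Cg; apply: Ck_sum => i; do 2 apply: Ck_partial. Qed.

Lemma laplacianD f g : Ck 2 f -> Ck 2 g ->
  laplacian (fun x => f x + g x) = fun x => laplacian f x + laplacian g x.
Proof.
move=> Cf Cg; apply/funext => x; rewrite /laplacian -big_split /=.
apply: eq_bigr => i _.
by rewrite partialD ?partialD //; (exact: Ck_partial || exact: CkW).
Qed.

Lemma laplacianZ c f : Ck 2 f ->
  laplacian (fun x => c * f x) = fun x => c * laplacian f x.
Proof.
move=> Cf; apply/funext => x; rewrite /laplacian mulr_sumr.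
apply: eq_bigr => i _.
by rewrite partialZ ?partialZ //; (exact: Ck_partial || exact: CkW).
Qed.

End differentiability_class.

(** * Stability of periodicity under the operations of the scheme *)

Section periodicity.
Context (R : realType) (d : nat) (a b : 'rV[R]_d).
Implicit Types (f g : 'rV[R]_d -> R).
Local Notation periodic := (periodic_box a b).

(** The difference quotients at [x] and at its translate by a period are the same function of the
    increment, hence have the same limit. *)
Lemma periodic_partial i g : periodic g -> periodic (partial i g).
Proof.
move=> pg j x; rewrite /partial /derive /=.
set T := _ *: delta_mx ord0 j.
have gT y : g (y + T) = g y := pg j y.
by under eq_fun do rewrite addrA !gT.
Qed.

Lemma periodicD f g : periodic f -> periodic g ->
  periodic (fun x => f x + g x).
Proof. by move=> pf pg j x; rewrite pf pg. Qed.

Lemma periodicM f g : periodic f -> periodic g ->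
  periodic (fun x => f x * g x).
Proof. by move=> pf pg j x; rewrite pf pg. Qed.

Lemma periodicZ c f : periodic f -> periodic (fun x => c * f x).
Proof. by move=> pf j x; rewrite pf. Qed.

Lemma periodic_laplacian g : periodic g -> periodic (laplacian g).
Proof.
move=> pg j x; apply: eq_bigr => i _.
exact: (@periodic_partial i _ (@periodic_partial i _ pg) j).
Qed.

End periodicity.

(** * Partial derivatives integrate to zero over a period *)

Section integration_by_parts.
Context (R : realType).

Lemma integral_derive1_eq0 (f : R -> R) (a b : R) : a < b ->
  (forall x, derivable f x 1) -> continuous (derive1 f) -> f a = f b ->
  (\int[lebesgue_measure]_(x in `]a, b[) (derive1 f x)%:E = 0)%E.
Proof.
move=> ab df cf' fab.
have cf : continuous f by move=> x; exact/differentiable_continuous/derivable1_diffP.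
(* Adding the endpoints does not change the integral, and the fundamental theorem is applied on the
   closed interval. *)
rewrite -(integral_itv_bndoo true false); last first.
  by apply: measurable_funTS; apply/measurable_EFinP; exact: continuous_measurable_fun.
rewrite (@continuous_FTC2 _ (derive1 f) f a b ab).
- by rewrite fab subee.
- exact: continuous_subspaceT.
- split=> [x _||]; first exact: df.
  + by apply: cvg_at_right_filter; exact: cf.
  + by apply: cvg_at_left_filter; exact: cf.
- by move=> x _.
Qed.

(** Moving the first coordinate is a translation along the first axis; this matches difference
    quotients of slices with those of the full function. *)
Lemma cons_rVDl n (x y : R) (t : 'rV[R]_n) :
  cons_rV (y + x) t = y *: delta_mx ord0 ord0 + cons_rV x t.
Proof.
apply: rV_consP => [|i]; rewrite [RHS]mxE !(cons_rV0, cons_rVS) !mxE !eqxx/=.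
  by rewrite mulr1.
by rewrite mulr0 add0r.
Qed.

Lemma cons_rVDr n (x y : R) (j : 'I_n) (t : 'rV[R]_n) :
  cons_rV x (y *: delta_mx ord0 j + t) =
  y *: delta_mx ord0 (lift ord0 j) + cons_rV x t.
Proof.
apply: rV_consP => [|i]; rewrite [RHS]mxE !(cons_rV0, cons_rVS) !mxE ?eqxx/=.
  by rewrite mulr0 add0r.
by rewrite (inj_eq lift_inj).
Qed.

Lemma continuous_cons_rVl n (t : 'rV[R]_n) : continuous (fun x : R => cons_rV x t).
Proof.
move=> x A /nbhs_ballP[e /= e0 eA]; apply/nbhs_ballP; exists e => //= y xy.
apply: eA; split=> // i j; rewrite (ord1 i).
case: (unliftP ord0 j) => [k ->|->]; last by rewrite !cons_rV0.
by rewrite !cons_rVS; exact: ballxx.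
Qed.

Lemma continuous_cons_rVr n (x : R) : continuous (@cons_rV R n x).
Proof.
move=> t A /nbhs_ballP[e /= e0 eA]; apply/nbhs_ballP; exists e => //= s [_ ts].
apply: eA; split=> // i j; rewrite (ord1 i).
case: (unliftP ord0 j) => [k ->|->]; first by rewrite !cons_rVS.
by rewrite !cons_rV0; exact: ballxx.
Qed.

Lemma derivable_cons_rVl n (g : 'rV[R]_n.+1 -> R) t x :
  derivable g (cons_rV x t) (delta_mx ord0 ord0) ->
  derivable (fun y : R => g (cons_rV y t)) x 1.
Proof.
move=> dg; rewrite /derivable; set D := (D in D @ _).
(* As a function of [h], the quotient of the slice is the quotient of [g] along the first axis, so
   convergence carries over. *)
suff -> : D = fun h => h^-1 *: ((g \o shift (cons_rV x t))
    (h *: delta_mx ord0 ord0) - g (cons_rV x t)) by [].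
by apply/funext => h; rewrite /D /= [h%:A]mulr1 cons_rVDl.
Qed.

Lemma derive1_cons_rVl n (g : 'rV[R]_n.+1 -> R) t :
  derive1 (fun y : R => g (cons_rV y t)) =
  fun x => partial ord0 g (cons_rV x t).
Proof.
apply/funext => x; rewrite /derive1 /partial /derive /=.
by under [in RHS]eq_fun do rewrite -cons_rVDl.
Qed.

Lemma partial_cons_rVr n (g : 'rV[R]_n.+1 -> R) j x :
  partial j (fun t => g (cons_rV x t)) =
  fun t => partial (lift ord0 j) g (cons_rV x t).
Proof.
apply/funext => t; rewrite /partial /derive /=.
by under [in LHS]eq_fun do rewrite cons_rVDr.
Qed.

Lemma derivable_cons_rVr n (g : 'rV[R]_n.+1 -> R) j x t :
  derivable g (cons_rV x t) (delta_mx ord0 (lift ord0 j)) ->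
  derivable (fun s => g (cons_rV x s)) t (delta_mx ord0 j).
Proof.
move=> dg; rewrite /derivable; set D := (D in D @ _).
suff -> : D = fun h => h^-1 *: ((g \o shift (cons_rV x t))
    (h *: delta_mx ord0 (lift ord0 j)) - g (cons_rV x t)) by [].
by apply/funext => h; rewrite /D /= cons_rVDr.
Qed.

(** Induction on the dimension. If [i] is not the first coordinate, each slice in the first
    coordinate is an instance one dimension lower; otherwise the inner integral is the one-variable
    case. *)
Lemma integral_partial_eq0 d (a b : 'rV[R]_d) (i : 'I_d) (g : 'rV[R]_d -> R) :
  (forall j, a ord0 j < b ord0 j) ->
  (forall x, derivable g x (delta_mx ord0 i)) -> continuous (partial i g) ->
  periodic g ((b ord0 i - a ord0 i) *: delta_mx ord0 i) ->
  (\int[lebesgue_rV (n := d)]_(x in openbox a b) (partial i g x)%:E = 0)%E.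
Proof.
elim: d a b i g => [|d IHd] a b i g ab dg cg pg; first by have := ltn_ord i.
have intg := continuous_box_integrable ab cg.
have mg := continuous_measurable_rV cg.
case: (unliftP ord0 i) dg cg pg intg mg => [j ->|->] dg cg pg intg mg.
  rewrite (integral_openbox_cons mg intg); apply: integral0_eq => x _.
  under eq_integral do rewrite -[partial _ _ _]/((fun t =>
    partial (lift ord0 j) g (cons_rV x t)) _) -partial_cons_rVr.
  apply: IHd => [k|t||t].
  - by rewrite !mxE.
  - by apply: derivable_cons_rVr.
  - rewrite partial_cons_rVr => t.
    by apply: continuous_comp; [exact: continuous_cons_rVr|exact: cg].
  - by rewrite !mxE addrC cons_rVDr addrC pg.
rewrite (integral_openbox_cons_swap mg intg); apply: integral0_eq => t _.
under eq_integral do rewrite -[partial _ _ _]/((fun x =>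
  partial ord0 g (cons_rV x t)) _) -derive1_cons_rVl.
apply: integral_derive1_eq0 => [|x||].
- exact: ab.
- by apply: derivable_cons_rVl.
- rewrite derive1_cons_rVl => x.
  by apply: continuous_comp; [exact: continuous_cons_rVl|exact: cg].
(* The right endpoint is the left endpoint plus one period. *)
- by rewrite -[b ord0 ord0](subrK (a ord0 ord0)) cons_rVDl addrC pg.
Qed.

End integration_by_parts.

(** * Real-valued integrals over the period box and Green's identities *)

Section box_integral.
Context (R : realType) (d : nat) (a b : 'rV[R]_d).
Hypothesis ab : forall i, a ord0 i < b ord0 i.
Implicit Types (f g : 'rV[R]_d -> R).
Local Notation "'\int' f" := (integral_box a b f) (at level 10).
Local Notation periodic := (periodic_box a b).

Lemma eq_integral_box f g : (forall x, openbox a b x -> f x = g x) ->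
  \int f = \int g.
Proof. by move=> fg; apply: eq_Rintegral => x /set_mem; exact: fg. Qed.

Lemma integral_boxD f g : continuous f -> continuous g ->
  \int (fun x => f x + g x) = \int f + \int g.
Proof.
move=> cf cg; apply: RintegralD.
- exact: measurable_openbox.
- exact: continuous_box_integrable.
- exact: continuous_box_integrable.
Qed.

Lemma integral_boxZ c f : continuous f ->
  \int (fun x => c * f x) = c * \int f.
Proof.
move=> cf; apply: RintegralZl; first exact: measurable_openbox.
exact: continuous_box_integrable.
Qed.

Lemma integral_box_sum n (F : 'I_n -> 'rV[R]_d -> R) :
  (forall i, continuous (F i)) ->
  \int (fun x => \sum_(i < n) F i x) = \sum_(i < n) \int (F i).
Proof.
elim: n F => [|n IHn] F cF.
  rewrite big_ord0; under eq_fun do rewrite big_ord0.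
  by rewrite /integral_box Rintegral_cst ?mul0r //; exact: measurable_openbox.
rewrite big_ord_recr -IHn //; under eq_fun do rewrite big_ord_recr.
apply: integral_boxD; last exact: cF.
(* [Ck 0] unfolds to continuity, so the closure lemmas for [Ck] at order 0 also prove continuity;
   later proofs reuse this. *)
by apply: (@Ck_sum _ _ 0) => i; exact: cF.
Qed.

Lemma le_integral_box f g : continuous f -> continuous g ->
  (forall x, f x <= g x) -> \int f <= \int g.
Proof.
move=> cf cg fg; apply: le_Rintegral => //.
- exact: measurable_openbox.
- exact: continuous_box_integrable.
- exact: continuous_box_integrable.
Qed.

(** With all terms on one side, the product rule leaves the integral of [partial i] of a periodic
    product. *)
Lemma integral_box_by_parts i f g : Ck 1 f -> Ck 1 g ->
  periodic f -> periodic g ->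
  \int (fun x => f x * partial i g x) = - \int (fun x => partial i f x * g x).
Proof.
move=> Cf Cg pf pg; apply/eqP; rewrite -addr_eq0 addrC; apply/eqP.
rewrite -integral_boxD; first last.
- exact: (@CkM _ _ 0 _ _ (CkW Cf) (Ck_partial i Cg)).
- exact: (@CkM _ _ 0 _ _ (Ck_partial i Cf) (CkW Cg)).
rewrite -partialM // /integral_box /Rintegral integral_partial_eq0 //.
- by apply: Ck_derivable; exact: (CkM Cf Cg).
- exact: (@Ck_partial _ _ 0 _ _ (CkM Cf Cg)).
- exact: (periodicM pf pg).
Qed.

Lemma integral_box_divergence f (V : 'rV[R]_d -> 'rV[R]_d) :
  Ck 1 f -> periodic f ->
  (forall i, Ck 1 (fun x => V x ord0 i)) ->
  (forall i, periodic (fun x => V x ord0 i)) ->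
  \int (fun x => f x * divergence V x) =
  - \int (fun x => \sum_(i < d) partial i f x * V x ord0 i).
Proof.
move=> Cf pf CV pV; rewrite integral_box_sum; last first.
  by move=> i; exact: (@CkM _ _ 0 _ _ (Ck_partial i Cf) (CkW (CV i))).
under eq_fun do rewrite mulr_sumr.
rewrite integral_box_sum; last first.
  by move=> i; exact: (@CkM _ _ 0 _ _ (CkW Cf) (Ck_partial i (CV i))).
by rewrite -sumrN; apply: eq_bigr => i _; exact: integral_box_by_parts.
Qed.

(** Green's first identity, from the Laplacian being the divergence of the gradient. *)
Lemma integral_box_laplacian f g : Ck 1 f -> Ck 2 g ->
  periodic f -> periodic g ->
  \int (fun x => f x * laplacian g x) =
  - \int (fun x => \sum_(i < d) partial i f x * partial i g x).
Proof.
move=> Cf Cg pf pg; have -> : laplacian g = divergence (grad g).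
  apply/funext => x; apply: eq_bigr => i _; congr (partial i _ _).
  by apply/funext => y; rewrite mxE.
have gradE i : (fun x => grad g x ord0 i) = partial i g.
  by apply/funext => x; rewrite mxE.
rewrite integral_box_divergence // => [|i|i]; rewrite ?gradE.
- by congr (- \int _); apply/funext => x; apply: eq_bigr => i _; rewrite mxE.
- exact: Ck_partial.
- exact: periodic_partial.
Qed.

(** Green's first identity applied to both sides gives the same expression, symmetric in [f] and
    [g]. *)
Lemma integral_box_laplacian_sym f g : Ck 2 f -> Ck 2 g ->
  periodic f -> periodic g ->
  \int (fun x => f x * laplacian g x) = \int (fun x => laplacian f x * g x).
Proof.
move=> Cf Cg pf pg; rewrite (integral_box_laplacian (CkW Cf) Cg pf pg).
have -> : (fun x => laplacian f x * g x) = (fun x => g x * laplacian f x).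
  by apply/funext => x; rewrite mulrC.
rewrite (integral_box_laplacian (CkW Cg) Cf pg pf); congr (- \int _).
by apply/funext => x; apply: eq_bigr => i _; rewrite mulrC.
Qed.

End box_integral.

(** * The scheme *)

Section linear_combination.
Context (R : realType) (d : nat).
Implicit Types (f g : 'rV[R]_d -> R).

Lemma Ck_lin k u v f g : Ck k f -> Ck k g -> Ck k (fun x => u * f x + v * g x).
Proof. by move=> Cf Cg; exact: CkD (CkZ u Cf) (CkZ v Cg). Qed.

Lemma periodic_lin (a b : 'rV[R]_d) u v f g :
  periodic_box a b f -> periodic_box a b g ->
  periodic_box a b (fun x => u * f x + v * g x).
Proof. by move=> pf pg; apply: periodicD; exact: periodicZ. Qed.

Lemma partial_lin i u v f g : Ck 1 f -> Ck 1 g ->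
  partial i (fun x => u * f x + v * g x) =
  fun x => u * partial i f x + v * partial i g x.
Proof.
move=> Cf Cg; rewrite (partialD i (CkZ u Cf) (CkZ v Cg)).
by rewrite (partialZ i u Cf) (partialZ i v Cg).
Qed.

Lemma laplacian_lin u v f g : Ck 2 f -> Ck 2 g ->
  laplacian (fun x => u * f x + v * g x) =
  fun x => u * laplacian f x + v * laplacian g x.
Proof.
move=> Cf Cg; rewrite (laplacianD (CkZ u Cf) (CkZ v Cg)).
by rewrite (laplacianZ u Cf) (laplacianZ v Cg).
Qed.

End linear_combination.

(** * Squared norms and the quadratic inequality for the G-norm *)

Lemma enorm_sqr (R : realType) (d : nat) (v : 'rV[R]_d) :
  enorm v ^+ 2 = \sum_(i < d) v ord0 i ^+ 2.
Proof. by rewrite sqr_sqrtr // sumr_ge0 // => i _; exact: sqr_ge0. Qed.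

Lemma L2norm_sqr (R : realType) (d : nat) (a b : 'rV[R]_d) (g : 'rV[R]_d -> R) :
  L2norm a b g ^+ 2 = integral_box a b (fun x => g x ^+ 2).
Proof. by rewrite sqr_sqrtr // Rintegral_ge0 // => x _; exact: sqr_ge0. Qed.

(** Here [u], [v], [w] are three successive values of [r], and the last factor is [tau] times the
    discrete derivative. The defect is a multiple of the squared second difference, nonnegative
    since [theta] is at least 1/2. *)
Lemma le_Gnorm2_increment (R : realType) (theta u v w : R) : 1 / 2 <= theta ->
  Gnorm2 theta u v - Gnorm2 theta v w <=
  2 * (theta * u + (1 - theta) * v) *
    ((theta + 1 / 2) * u - 2 * theta * v + (theta - 1 / 2) * w).
Proof.
move=> theta_ge; rewrite -subr_ge0 /Gnorm2; set lhs := (X in 0 <= X).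
have -> : lhs = theta * (2 * theta - 1) / 2 * (u - 2 * v + w) ^+ 2.
  by rewrite /lhs; field.
rewrite mulr_ge0 ?sqr_ge0 // divr_ge0 //.
by apply: mulr_ge0; lra.
Qed.

(** * Lower bounds for the three stabilization terms *)

Section stabilization.
Context (R : realType) (d : nat) (a b : 'rV[R]_d) (theta tau : R).
Hypothesis ab : forall i, a ord0 i < b ord0 i.
Hypothesis theta_ge : 1 / 2 <= theta.
Hypothesis tau_gt0 : 0 < tau.
Implicit Types (p q : 'rV[R]_d -> R).
Local Notation "'\int' f" := (integral_box a b f) (at level 10).

(* If [p = phi^(n+1) - phi^n] and [q = phi^n - phi^(n-1)], then [diff2 p q] is
   the second difference of [phi] and [Dincr p q] is [D_tau^theta phi]; both are
   written in the shape [u * p + v * q] of the lemmas on linear combinations. *)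
Definition diff2 p q : 'rV[R]_d -> R := fun x => 1 * p x + (-1) * q x.
Definition Dincr p q : 'rV[R]_d -> R :=
  fun x => (theta + 1 / 2) / tau * p x + (1 / 2 - theta) / tau * q x.

(** Pointwise, the integrands differ by [theta / tau * (p x - q x) ^+ 2]. Stated for arbitrary
    continuous functions, it also applies to partial derivatives and Laplacians of increments. *)
Lemma le_integral_diff2_Dincr p q : continuous p -> continuous q ->
  (\int (fun x => p x ^+ 2) - \int (fun x => q x ^+ 2)) / (2 * tau) <=
  \int (fun x => diff2 p q x * Dincr p q x).
Proof.
move=> cp cq; have cpp := @CkM _ _ 0 _ _ cp cp; have cqq := @CkM _ _ 0 _ _ cq cq.
have -> : (\int (fun x => p x ^+ 2) - \int (fun x => q x ^+ 2)) / (2 * tau) =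
    \int (fun x => (2 * tau)^-1 * (p x * p x) + - (2 * tau)^-1 * (q x * q x)).
  rewrite (integral_boxD ab (@CkZ _ _ 0 _ _ cpp) (@CkZ _ _ 0 _ _ cqq)).
  rewrite (integral_boxZ ab _ cpp) (integral_boxZ ab _ cqq).
  by rewrite mulrC mulNr -mulrBr.
apply: (le_integral_box ab (@Ck_lin _ _ 0 _ _ _ _ cpp cqq)
  (@CkM _ _ 0 _ _ (@Ck_lin _ _ 0 _ _ _ _ cp cq)
     (@Ck_lin _ _ 0 _ _ _ _ cp cq))) => x.
rewrite -subr_ge0 /diff2 /Dincr.
have -> : (1 * p x + -1 * q x) *
    ((theta + 1 / 2) / tau * p x + (1 / 2 - theta) / tau * q x) -
    ((2 * tau)^-1 * (p x * p x) + - (2 * tau)^-1 * (q x * q x)) =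
    theta / tau * (p x - q x) ^+ 2 by field; rewrite lt0r_neq0.
apply: mulr_ge0; last exact: sqr_ge0.
by apply: divr_ge0; [move: theta_ge; lra|exact: ltW].
Qed.

Context (p q : 'rV[R]_d -> R).
Hypotheses (Cp : Ck 4 p) (Cq : Ck 4 q).
Hypotheses (pp : periodic_box a b p) (pq : periodic_box a b q).

Lemma Ck_diff2 : Ck 4 (diff2 p q).
Proof. exact: Ck_lin _ _ Cp Cq. Qed.

Lemma Ck_Dincr : Ck 4 (Dincr p q).
Proof. exact: Ck_lin _ _ Cp Cq. Qed.

Lemma periodic_diff2 : periodic_box a b (diff2 p q).
Proof. exact: periodic_lin. Qed.

Lemma periodic_Dincr : periodic_box a b (Dincr p q).
Proof. exact: periodic_lin. Qed.

(** Green's first identity yields a sum over coordinates. As [partial i] commutes with [diff2] and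
    [Dincr], the previous estimate applies to each pair of partial derivatives. *)
Lemma le_integral_laplacian_diff2 :
  (\int (fun x => \sum_(i < d) partial i p x ^+ 2) -
   \int (fun x => \sum_(i < d) partial i q x ^+ 2)) / (2 * tau) <=
  - \int (fun x => laplacian (diff2 p q) x * Dincr p q x).
Proof.
have Cd := Ck_diff2; have Cw := Ck_Dincr.
have -> : (fun x => laplacian (diff2 p q) x * Dincr p q x) =
    (fun x => Dincr p q x * laplacian (diff2 p q) x).
  by apply/funext => x; rewrite mulrC.
have Cd2 : Ck 2 (diff2 p q) := @Ck_leq _ _ 2 4 _ isT Cd.
have Cw1 : Ck 1 (Dincr p q) := @Ck_leq _ _ 1 4 _ isT Cw.
rewrite (integral_box_laplacian ab Cw1 Cd2 periodic_Dincr periodic_diff2).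
have [Cp1 Cq1] : Ck 1 p /\ Ck 1 q.
  by split; [exact: @Ck_leq _ _ 1 4 _ isT Cp|exact: @Ck_leq _ _ 1 4 _ isT Cq].
have cpart i (g : 'rV[R]_d -> R) : Ck 4 g -> continuous (partial i g).
  by move=> /(Ck_partial i)/Ck_continuous.
have csum f g : Ck 4 f -> Ck 4 g ->
    \int (fun x => \sum_(i < d) partial i f x * partial i g x) =
    \sum_(i < d) \int (fun x => partial i f x * partial i g x).
  move=> Cf Cg; apply: (integral_box_sum ab) => i.
  exact: (@CkM _ _ 0 _ _ (cpart i f Cf) (cpart i g Cg)).
rewrite opprK (csum _ _ Cp Cp) (csum _ _ Cq Cq) (csum _ _ Cw Cd).
rewrite -sumrB mulr_suml; apply: ler_sum => i _.
have -> : (fun x => partial i (Dincr p q) x * partial i (diff2 p q) x) =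
    (fun x => diff2 (partial i p) (partial i q) x *
              Dincr (partial i p) (partial i q) x).
  apply/funext => x; rewrite mulrC /Dincr /diff2.
  by rewrite !(partial_lin _ _ _ Cp1 Cq1).
exact: le_integral_diff2_Dincr (cpart i p Cp) (cpart i q Cq).
Qed.

(** Symmetry of the Laplacian moves one of the two onto [Dincr p q]; the basic estimate is then
    applied to [laplacian p] and [laplacian q]. *)
Lemma le_integral_bilaplacian_diff2 :
  (\int (fun x => laplacian p x ^+ 2) -
   \int (fun x => laplacian q x ^+ 2)) / (2 * tau) <=
  \int (fun x => laplacian (laplacian (diff2 p q)) x * Dincr p q x).
Proof.
have Cd := Ck_diff2; have Cw := Ck_Dincr.
have Cw2 : Ck 2 (Dincr p q) := @Ck_leq _ _ 2 4 _ isT Cw.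
have [Cp2 Cq2] : Ck 2 p /\ Ck 2 q.
  by split; [exact: @Ck_leq _ _ 2 4 _ isT Cp|exact: @Ck_leq _ _ 2 4 _ isT Cq].
rewrite -(integral_box_laplacian_sym ab (Ck_laplacian Cd) Cw2
  (periodic_laplacian periodic_diff2) periodic_Dincr).
have E : (fun x => diff2 (laplacian p) (laplacian q) x *
                   Dincr (laplacian p) (laplacian q) x) =
    (fun x => laplacian (diff2 p q) x * laplacian (Dincr p q) x).
  apply/funext => x; rewrite /Dincr /diff2.
  by rewrite !(laplacian_lin _ _ Cp2 Cq2).
apply: le_trans (le_integral_diff2_Dincr (Ck_continuous (Ck_laplacian Cp))
  (Ck_continuous (Ck_laplacian Cq))) _.
by rewrite (congr1 (integral_box a b) E).
Qed.

End stabilization.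

(** Adds the four estimates. Abstract reals replace the integrals, and splitting [(2 * tau)^-1]
    makes the goal linear in monomials containing [tau^-1]. *)
Lemma energy_balance (R : realType)
    (tau G G' I1 I2 I3 P1 Q1 P2 Q2 P3 Q3 s1 s2 s3 F : R) :
  (G - G') / tau <= F -> s1 * ((P1 - Q1) / (2 * tau)) <= s1 * I1 ->
  s2 * ((P2 - Q2) / (2 * tau)) <= s2 * - I2 ->
  s3 * ((P3 - Q3) / (2 * tau)) <= s3 * I3 ->
  1 / tau * ((G + s1 * (P1 / 2) + s2 * (P2 / 2) + s3 * (P3 / 2)) -
             (G' + s1 * (Q1 / 2) + s2 * (Q2 / 2) + s3 * (Q3 / 2))) <=
  F + s1 * I1 - s2 * I2 + s3 * I3.
Proof. by rewrite invfM div1r; lra. Qed.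

(** * Testing the equations of the scheme and decay of the energy *)

Section scheme.
Context (R : realType) (d : nat) (a b : 'rV[R]_d).
Context (alpha beta eps C M0 theta tau S1 S2 S3 : R) (M : R -> R).
Context (phi : nat -> 'rV[R]_d -> R) (r : nat -> R).
Hypothesis ab : forall i, a ord0 i < b ord0 i.
Hypothesis M_ge : forall s, M0 <= M s.
Hypothesis M0_gt0 : 0 < M0.
Hypothesis theta_ge : 1 / 2 <= theta.
Hypothesis tau_gt0 : 0 < tau.
Hypotheses (S1_gt0 : 0 < S1) (S2_gt0 : 0 < S2) (S3_gt0 : 0 < S3).
Hypothesis phi_periodic : forall n, periodic_box a b (phi n).
Hypothesis phi_C4 : forall n, Ck 4 (phi n).
Local Notation "'\int' f" := (integral_box a b f) (at level 10).

(** The explicit coefficients fit the lemmas on linear combinations. *)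
Let incr n : 'rV[R]_d -> R := fun x => 1 * phi n.+1 x + (-1) * phi n x.

Let Ck_incr n : Ck 4 (incr n).
Proof. exact: Ck_lin _ _ (phi_C4 n.+1) (phi_C4 n). Qed.

Let phi_Ck k n : (k <= 4)%N -> Ck k (phi n).
Proof. by move=> k4; exact: Ck_leq k4 (phi_C4 n). Qed.

Let periodic_incr n : periodic_box a b (incr n).
Proof. exact: periodic_lin. Qed.

Let E_W_incr n : E_W a b eps theta S1 S2 S3 phi r n.+1 =
  Gnorm2 theta (r n.+1) (r n)
  + S1 / eps ^+ 2 * (\int (fun x => incr n x ^+ 2) / 2)
  + S2 * (\int (fun x => \sum_(i < d) partial i (incr n) x ^+ 2) / 2)
  + S3 * (\int (fun x => laplacian (incr n) x ^+ 2) / 2).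
Proof.
rewrite /E_W /= !L2norm_sqr; congr (_ + _ * (\int _ / 2) +
  _ * (\int _ / 2) + _ * (\int _ / 2)); apply/funext => x.
- by rewrite /incr mul1r mulN1r.
- rewrite enorm_sqr; apply: eq_bigr => i _; rewrite !mxE.
  by rewrite (partial_lin _ _ _ (@phi_Ck 1 _ isT) (@phi_Ck 1 _ isT)) mul1r mulN1r.
- by rewrite (laplacian_lin _ _ (@phi_Ck 2 _ isT) (@phi_Ck 2 _ isT)) mul1r mulN1r.
Qed.

Let Dtau_phiE n : Dtau_phi theta tau phi n.+1 =
  Dincr theta tau (incr n.+1) (incr n).
Proof.
apply/funext => x; rewrite /Dtau_phi /Dtau /Dincr /incr /=.
by field; rewrite lt0r_neq0.
Qed.

Let delta2_phiE n : delta2_phi phi n.+1 = diff2 (incr n.+1) (incr n).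
Proof.
by apply/funext => x; rewrite /delta2_phi /diff2 /incr /=; ring.
Qed.

Lemma energy_test n mu :
  UW_regular a b alpha beta eps C M theta tau phi n mu ->
  UW_step a b alpha beta eps C M theta tau S1 S2 S3 phi r n mu ->
  \int (fun x => mu x * Dtau_phi theta tau phi n x) =
  - dissipation a b M theta phi n mu.
Proof.
move=> [_ pmu Cmu Cflux] [Dphi _ _].
set V := fun y => M_star M theta phi n y *: grad mu y in Dphi.
have VE i : (fun x => V x ord0 i) =
    fun x => M_star M theta phi n x * partial i mu x.
  by apply/funext => x; rewrite !mxE.
(* The mobility depends on the point only through [phi], so the flux inherits periodicity. *)
have pM : periodic_box a b (M_star M theta phi n).
  by move=> j x; rewrite /M_star /phi_star !phi_periodic.
(* The evolution equation is given only inside the box, which suffices under the integral. *)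
rewrite (@eq_integral_box _ _ _ _ _ (fun x => mu x * divergence V x)); last first.
  by move=> x abx; rewrite Dphi.
rewrite (integral_box_divergence ab Cmu pmu) => [|i|i]; last 2 first.
- by rewrite VE; exact: Cflux.
- by rewrite VE; exact: periodicM pM (periodic_partial i pmu).
rewrite /dissipation L2norm_sqr; congr (- \int _); apply/funext => x.
rewrite enorm_sqr; apply: eq_bigr => i _; rewrite !mxE exprMn sqr_sqrtr.
  by rewrite expr2 mulrCA.
exact: ltW (lt_le_trans M0_gt0 (M_ge _)).
Qed.

(** The second equation tested with the discrete time derivative [w]; the third one then replaces
    the integral of [Z * w]. *)
Lemma energy_expand n mu :
  UW_regular a b alpha beta eps C M theta tau phi n.+1 mu ->
  UW_step a b alpha beta eps C M theta tau S1 S2 S3 phi r n.+1 mu ->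
  let w := Dincr theta tau (incr n.+1) (incr n) in
  let e := diff2 (incr n.+1) (incr n) in
  \int (fun x => mu x * w x) =
  2 * r_theta theta r n.+1 * Dtau theta tau r n.+1
  + S1 / eps ^+ 2 * \int (fun x => e x * w x)
  - S2 * \int (fun x => laplacian e x * w x)
  + S3 * \int (fun x => laplacian (laplacian e) x * w x).
Proof.
move=> [intZ _ Cmu _] [_ muE Dr] w e.
rewrite Dtau_phiE -/w in intZ Dr; rewrite delta2_phiE -/e in muE.
set Z := Z_star _ _ _ _ _ _ _ _ _ in intZ muE Dr.
set rt := r_theta _ _ _ in muE *.
have Ce : Ck 4 e := Ck_diff2 (Ck_incr n.+1) (Ck_incr n).
have Cw : Ck 4 w := Ck_Dincr theta tau (Ck_incr n.+1) (Ck_incr n).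
have cw : Ck 0 w := Ck_continuous Cw.
have c1 : Ck 0 (fun x => e x * w x).
  exact: @CkM _ _ 0 _ _ (Ck_continuous Ce) cw.
have c2 : Ck 0 (fun x => laplacian e x * w x).
  exact: @CkM _ _ 0 _ _ (Ck_continuous (Ck_laplacian Ce)) cw.
have c3 : Ck 0 (fun x => laplacian (laplacian e) x * w x).
  exact: @CkM _ _ 0 _ _ (Ck_laplacian (Ck_laplacian Ce)) cw.
set le := laplacian e in muE c2 c3 *; set lle := laplacian le in muE c3 *.
(* From here only continuity, integrability and the two scheme equations matter, so the functions
   are made opaque. *)
clearbody lle le e w Z rt.
(* Collects the continuous stabilization terms; the [Z] term, possibly singular, is kept apart and
   is only known to be integrable. *)
pose h x := S1 / eps ^+ 2 * (e x * w x) + (- S2 * (le x * w x)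
            + S3 * (lle x * w x)).
have c23 := @Ck_lin _ _ 0 (- S2) S3 _ _ c2 c3.
have ch : Ck 0 h := @CkD _ _ 0 _ _ (@CkZ _ _ 0 _ _ c1) c23.
have mB := measurable_openbox a b.
have intrZ : (lebesgue_rV (n := d)).-integrable (openbox a b)
    (EFin \o (fun x => rt * (Z x * w x))).
  exact: (integrableZl mB rt intZ).
have inth := continuous_box_integrable ab ch.
(* The equation for [mu] holds almost everywhere, hence the passage through almost-everywhere equal
   integrands. *)
have -> : \int (fun x => mu x * w x) = \int (fun x => rt * (Z x * w x) + h x).
  congr fine; apply: ae_eq_integral.
  - exact: mB.
  - apply: measurable_funTS; apply/measurable_EFinP.
    apply: continuous_measurable_rV.
    exact: (@CkM _ _ 0 _ _ (Ck_continuous Cmu) cw).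
  - exact: (measurable_int _ (integrableD mB intrZ inth)).
  - apply: filterS muE => x muE abx; rewrite (muE abx) /h; congr EFin; ring.
have -> : \int (fun x => rt * (Z x * w x) + h x) =
    rt * \int (fun x => Z x * w x) + \int h.
  by rewrite /integral_box (RintegralD mB intrZ inth) (RintegralZl rt mB intZ).
rewrite /h (integral_boxD ab (@CkZ _ _ 0 _ _ c1) c23).
rewrite (integral_boxD ab (@CkZ _ _ 0 _ _ c2) (@CkZ _ _ 0 _ _ c3)).
rewrite (integral_boxZ ab (S1 / _) c1) (integral_boxZ ab (- S2) c2).
rewrite (integral_boxZ ab S3 c3) mulNr !addrA; congr (_ + _ - _ + _).
by rewrite Dr; move: (integral_box _ _ _) => J; field.
Qed.

(** Indexing by [n.+1] makes the previous level [n] a genuine predecessor, so both energies can be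
    written with [incr]. *)
Lemma energy_decay n mu :
  UW_regular a b alpha beta eps C M theta tau phi n.+1 mu ->
  UW_step a b alpha beta eps C M theta tau S1 S2 S3 phi r n.+1 mu ->
  1 / tau * (E_W a b eps theta S1 S2 S3 phi r n.+2 -
             E_W a b eps theta S1 S2 S3 phi r n.+1) <=
  - dissipation a b M theta phi n.+1 mu.
Proof.
move=> reg step; rewrite -(energy_test reg step) Dtau_phiE.
rewrite (energy_expand reg step) !E_W_incr.
set p := incr n.+1; set q := incr n.
have H1 := le_integral_diff2_Dincr ab theta_ge tau_gt0
  (Ck_continuous (Ck_incr n.+1)) (Ck_continuous (Ck_incr n)).
have H2 := le_integral_laplacian_diff2 ab theta_ge tau_gt0
  (Ck_incr n.+1) (Ck_incr n) (periodic_incr n.+1) (periodic_incr n).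
have H3 := le_integral_bilaplacian_diff2 ab theta_ge tau_gt0
  (Ck_incr n.+1) (Ck_incr n) (periodic_incr n.+1) (periodic_incr n).
rewrite -/p -/q in H1 H2 H3.
(* The G-norm inequality divided by [tau], which restores the factor inside [Dtau]. *)
have KG : (Gnorm2 theta (r n.+2) (r n.+1) - Gnorm2 theta (r n.+1) (r n)) / tau
    <= 2 * r_theta theta r n.+1 * Dtau theta tau r n.+1.
  rewrite /Dtau /r_theta /= mulrA ler_pM2r ?invr_gt0 //.
  exact: le_Gnorm2_increment.
have S1e : 0 <= S1 / eps ^+ 2 by rewrite divr_ge0 ?sqr_ge0 // ltW.
move: KG (ler_wpM2l S1e H1) (ler_wpM2l (ltW S2_gt0) H2)
  (ler_wpM2l (ltW S3_gt0) H3).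
exact: energy_balance.
Qed.

End scheme.

Theorem theorem3p3 (R : realType) (d : nat) (a b : 'rV[R]_d)
    (alpha beta eps C M0 theta tau S1 S2 S3 : R) (M : R -> R)
    (phi mu : nat -> 'rV[R]_d -> R) (r : nat -> R)
    (hd : d = 2%N \/ d = 3%N)
    (hab : forall i, a ord0 i < b ord0 i)
    (halpha : 0 <= alpha) (hbeta : 0 < beta) (heps : 0 < eps) (hC : 0 < C)
    (hM0 : 0 < M0) (hM : forall s, M0 <= M s)
    (htheta : 1 / 2 <= theta <= 1) (htau : 0 < tau)
    (hS1 : 0 < S1) (hS2 : 0 < S2) (hS3 : 0 < S3)
    (hphi_periodic : forall n, periodic_box a b (phi n))
    (hphi_C4 : forall n, Ck 4 (phi n))
    (hradicand : forall n, (1 <= n)%N ->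
       0 < radicand a b alpha beta eps C (phi_star theta phi n))
    (hregular : forall n, (1 <= n)%N ->
       UW_regular a b alpha beta eps C M theta tau phi n (mu n))
    (hscheme : forall n, (1 <= n)%N ->
       UW_step a b alpha beta eps C M theta tau S1 S2 S3 phi r n (mu n)) :
  forall n, (1 <= n)%N ->
    let E := E_W a b eps theta S1 S2 S3 phi r in
    let D := dissipation a b M theta phi n (mu n) in
    1 / tau * (E n.+1 - E n) <= - D /\ - D <= 0.
Proof.
move=> [//|n] n_ge1 E D; have /andP[theta_ge _] := htheta; split.
  exact: (energy_decay hab hM hM0 theta_ge htau hS1 hS2 hS3 hphi_periodic
    hphi_C4 (hregular n.+1 n_ge1) (hscheme n.+1 n_ge1)).
by rewrite oppr_le0; exact: sqr_ge0.
Qed.
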